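(* Let $D\subseteq\mathbb{R}^d$, let $K:D\times D\to\mathbb{R}$ be a covariance function, let $\mathbf{x}^1,\dots,\mathbf{x}^n\in D$ be data points (not necessarily distinct) with outputs $\mathbf{y}\in\mathbb{R}^n$, and let $\mathbf{C}=(K(\mathbf{x}^i,\mathbf{x}^j))_{1\le i,j\le n}$, which need not be invertible. Then the mean and covariance of the conditional Gaussian process regularized by nugget tend toward those of the Gaussian process regularized by pseudoinverse as the nugget value $\tau^2>0$ tends to $0$: for all $\mathbf{x},\mathbf{x}'\in D$, $$\lim_{\tau^2\to 0^+} m^{Nug}(\mathbf{x})=m^{PI}(\mathbf{x})\quad\text{and}\quad \lim_{\tau^2\to 0^+} c^{Nug}(\mathbf{x},\mathbf{x}')=c^{PI}(\mathbf{x},\mathbf{x}').$$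
   Context: A covariance function is a symmetric positive semidefinite kernel. For $\mathbf{x}\in D$, $\mathbf{c}(\mathbf{x})=(K(\mathbf{x},\mathbf{x}^1),\dots,K(\mathbf{x},\mathbf{x}^n))^\top$. The Gaussian process has zero prior mean and kernel $K$. Pseudoinverse regularization: $m^{PI}(\mathbf{x})=\mathbf{c}(\mathbf{x})^\top\mathbf{C}^\dagger\mathbf{y}$ and $c^{PI}(\mathbf{x},\mathbf{x}')=K(\mathbf{x},\mathbf{x}')-\mathbf{c}(\mathbf{x})^\top\mathbf{C}^\dagger\mathbf{c}(\mathbf{x}')$, where $\mathbf{C}^\dagger$ is the Moore–Penrose pseudoinverse of $\mathbf{C}$. Nugget regularization with nugget value $\tau^2>0$: $m^{Nug}(\mathbf{x})=\mathbf{c}(\mathbf{x})^\top(\mathbf{C}+\tau^2\mathbf{I})^{-1}\mathbf{y}$ and $c^{Nug}(\mathbf{x},\mathbf{x}')=K(\mathbf{x},\mathbf{x}')-\mathbf{c}(\mathbf{x})^\top(\mathbf{C}+\tau^2\mathbf{I})^{-1}\mathbf{c}(\mathbf{x}')$, where $\mathbf{I}$ is the $n\times n$ identity matrix. *)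

(* Defs.v *)
From HB Require Import structures.
From mathcomp Require Import all_boot all_order all_algebra.
From mathcomp Require Import all_classical all_reals all_analysis.

Set Implicit Arguments.
Unset Strict Implicit.
Unset Printing Implicit Defensive.

Import Order.TTheory GRing.Theory Num.Theory.
Import numFieldNormedType.Exports.

Local Open Scope classical_set_scope.
Local Open Scope ring_scope.

(* The index set T is arbitrary: a kernel on a subset D of a space is a map
   D -> D -> R out of the subtype of D. The points u i may repeat. *)
Definition covariance_function (R : realType) (T : Type) (K : T -> T -> R)
    : Prop :=
  (forall x x', K x x' = K x' x) /\
  (forall (m : nat) (u : 'I_m -> T) (a : 'I_m -> R),
     0 <= \sum_(i < m) \sum_(j < m) a i * a j * K (u i) (u j)).

(* The four Penrose equations; over a real field the adjoint is the
   transpose. *)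
Definition is_moore_penrose (R : realType) (m n : nat)
    (A : 'M[R]_(m, n)) (X : 'M[R]_(n, m)) : Prop :=
  [/\ A *m X *m A = A,
      X *m A *m X = X,
      (A *m X)^T = A *m X &
      (X *m A)^T = X *m A].

(* The default value 0 is never used: see pinvP and pinv_unique below. The
   library's pinvmx is a different object: it need not satisfy the two symmetry
   equations. *)
Definition pinv (R : realType) (m n : nat) (A : 'M[R]_(m, n)) : 'M[R]_(n, m) :=
  xget 0 [set X | is_moore_penrose A X].

Section GaussianProcess.
Variables (R : realType) (T : Type) (n : nat).
Variables (K : T -> T -> R) (X : 'I_n -> T) (y : 'cV[R]_n).

Definition cov_mx : 'M[R]_n := \matrix_(i, j) K (X i) (X j).

Definition cov_vec (x : T) : 'cV[R]_n := \col_i K x (X i).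

Definition mean_PI (x : T) : R :=
  ((cov_vec x)^T *m pinv cov_mx *m y) 0 0.

Definition cov_PI (x x' : T) : R :=
  K x x' - ((cov_vec x)^T *m pinv cov_mx *m cov_vec x') 0 0.

(* tau2 is the nugget value itself, i.e. the square of tau. For positive
   semidefinite K and tau2 > 0 the matrix inverted here is a unit. *)
Definition mean_Nug (tau2 : R) (x : T) : R :=
  ((cov_vec x)^T *m invmx (cov_mx + tau2%:M) *m y) 0 0.

Definition cov_Nug (tau2 : R) (x x' : T) : R :=
  K x x' - ((cov_vec x)^T *m invmx (cov_mx + tau2%:M) *m cov_vec x') 0 0.

End GaussianProcess.

Section MoorePenrose.
Variable R : realType.

Lemma gram_unitmx (r n : nat) (B : 'M[R]_(r, n)) :
  row_free B -> B *m B^T \in unitmx.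
Proof.
move=> fB; rewrite -row_free_unit -kermx_eq0; apply/rowV0P => u.
move/sub_kermxP => uB0; suff uB : u *m B = 0.
  by apply: (row_free_inj fB); rewrite uB mul0mx.
have : (u *m B *m (u *m B)^T) 0 0 = 0.
  by rewrite trmx_mul mulmxA -(mulmxA u) uB0 mul0mx mxE.
move: (u *m B) => v; rewrite mxE => /eqP.
rewrite psumr_eq0 => [/allP h|j _]; last by rewrite [v^T _ _]mxE -expr2 sqr_ge0.
apply/rowP => j; move: (h j (mem_index_enum _)).
by rewrite [v^T _ _]mxE [RHS]mxE /= mulf_eq0 orbb => /eqP.
Qed.

Lemma moore_penrose_exists (m n : nat) (A : 'M[R]_(m, n)) :
  exists X, is_moore_penrose A X.
Proof.
have [r [B [C [-> fB fC]]]] : exists r (B : 'M[R]_(m, r)) (C : 'M[R]_(r, n)),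
    [/\ A = B *m C, row_free B^T & row_free C].
  exists (\rank A), (col_base A), (row_base A).
  rewrite mulmx_base row_base_free; split=> //.
  by rewrite /row_free mxrank_tr; exact: col_base_full.
have uC : C *m C^T \in unitmx by exact: gram_unitmx.
have uB : B^T *m B \in unitmx by rewrite -{2}(trmxK B); exact: gram_unitmx.
have sym k (M : 'M[R]_(k, k)) : M^T = M -> (invmx M)^T = invmx M.
  by move=> h; rewrite trmx_inv h.
have sC : (invmx (C *m C^T))^T = invmx (C *m C^T).
  by apply: sym; rewrite trmx_mul trmxK.
have sB : (invmx (B^T *m B))^T = invmx (B^T *m B).
  by apply: sym; rewrite trmx_mul trmxK.
pose P := C^T *m invmx (C *m C^T); pose Q := invmx (B^T *m B) *m B^T.
have CP : C *m P = 1%:M by rewrite /P mulmxA mulmxV.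
have QB : Q *m B = 1%:M by rewrite /Q -mulmxA mulVmx.
have AX : B *m C *m (P *m Q) = B *m Q.
  by rewrite mulmxA -(mulmxA B) CP mulmx1.
have XA : P *m Q *m (B *m C) = P *m C.
  by rewrite mulmxA -(mulmxA P) QB mulmx1.
exists (P *m Q); split.
- by rewrite AX mulmxA -(mulmxA B) QB mulmx1.
- by rewrite XA mulmxA -(mulmxA P) CP mulmx1.
- by rewrite AX /Q !trmx_mul trmxK sB mulmxA.
- by rewrite XA /P !trmx_mul trmxK sC mulmxA.
Qed.

Lemma moore_penrose_unique (m n : nat) (A : 'M[R]_(m, n)) X Y :
  is_moore_penrose A X -> is_moore_penrose A Y -> X = Y.
Proof.
move=> [x1 x2 x3 x4] [y1 y2 y3 y4].
have AXY : A *m X = A *m Y.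
  by rewrite -x3 -{1}y1 -(mulmxA (A *m Y)) trmx_mul x3 y3 mulmxA x1.
have XYA : X *m A = Y *m A.
  by rewrite -x4 -{1}y1 -!mulmxA mulmxA trmx_mul x4 y4 -mulmxA (mulmxA A) x1.
by rewrite -x2 XYA -mulmxA AXY mulmxA y2.
Qed.

Lemma pinvP (m n : nat) (A : 'M[R]_(m, n)) : is_moore_penrose A (pinv A).
Proof.
have [X HX] := moore_penrose_exists A.
by rewrite /pinv; case: xgetP => [Z -> //|/(_ X)].
Qed.

Lemma pinv_unique (m n : nat) (A : 'M[R]_(m, n)) X :
  is_moore_penrose A X -> X = pinv A.
Proof. by move=> HX; exact: moore_penrose_unique HX (pinvP A). Qed.

End MoorePenrose.

(* Main.v *)
Require Import Defs.
From HB Require Import structures.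
From mathcomp Require Import all_boot all_order all_algebra.
From mathcomp Require Import all_classical all_reals all_analysis.
From mathcomp Require Import ring lra.

Import Order.TTheory GRing.Theory Num.Theory.
Import numFieldNormedType.Exports.

Local Open Scope classical_set_scope.
Local Open Scope ring_scope.

(** Write C for the covariance matrix, P for its pseudoinverse and c for the
vector of covariances between a point and the data. Both limits are instances
of the convergence of c^T (C + t I)^-1 v to c^T P v, for an arbitrary vector v.

This fails for an arbitrary c, since (C + t I)^-1 blows up like 1/t on the
kernel of C. Positive semidefiniteness of K on the data points together with
the extra point forces c to be orthogonal to that kernel, so that c = C w for
some w (cov_vec_sub); this is the only property of c that matters.

It remains to follow C (C + t I)^-1 as t tends to 0. As C is symmetric, P
commutes with C, and the Penrose equation C P C = C gives
(I + t P) C = C P (C + t I). Hence C (C + t I)^-1 = (I + t P)^-1 C P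
(mulmx_ridge), where the singular inverse has been traded for the inverse of a
perturbation of the identity. The entries of the latter are rational functions
of t, continuous at 0 (cvg_invmx1D), so the limit is w^T C P v = c^T P v. *)

Section Resolvent.
Variables (R : realType) (n : nat).
Implicit Types C P : 'M[R]_n.

Let pencil P : 'M[{poly R}]_n := 1%:M + 'X *: map_mx polyC P.

Let pencilE P t : map_mx (horner_eval t) (pencil P) = 1%:M + t *: P.
Proof.
apply/matrixP => i j; rewrite !mxE /horner_eval hornerD hornerM hornerX hornerC.
by rewrite -polyC_natr hornerC.
Qed.

Let detE P t : \det (1%:M + t *: P) = (\det (pencil P)).[t].
Proof. by rewrite -pencilE det_map_mx. Qed.

Lemma near_unitmx1D P : \forall t \near 0, 1%:M + t *: P \in unitmx.
Proof.
have d0 : (\det (pencil P)).[0] != 0.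
  by rewrite -detE scale0r addr0 det1 oner_neq0.
have := @continuous_horner _ (\det (pencil P)) 0.
move=> /cvgr_neq0/(_ d0); apply: filterS => t.
by rewrite unitmxE unitfE detE.
Qed.

(** Cramer's rule: the determinant and the adjugate of I + t P are evaluations
at t of polynomial matrices, so continuity reduces to that of polynomials. *)
Lemma cvg_invmx1D P (u : 'rV[R]_n) (v : 'cV[R]_n) :
  (u *m invmx (1%:M + t *: P) *m v) 0 0 @[t --> 0] --> (u *m v) 0 0.
Proof.
pose d := \det (pencil P).
pose a := (map_mx polyC u *m \adj (pencil P) *m map_mx polyC v) 0 0.
have entryE t : 1%:M + t *: P \in unitmx ->
    (u *m invmx (1%:M + t *: P) *m v) 0 0 = d.[t]^-1 * a.[t].
  move=> U; rewrite /invmx U detE -scalemxAr -scalemxAl mxE; congr (_ * _).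
  rewrite -pencilE -map_mx_adj.
  have evalC m k (M : 'M[R]_(m, k)) :
      M = map_mx (horner_eval t) (map_mx polyC M).
    by apply/matrixP => i j; rewrite !mxE /horner_eval hornerC.
  by rewrite {1}(evalC _ _ u) {1}(evalC _ _ v) -!map_mxM mxE.
have lim : d.[t]^-1 * a.[t] @[t --> 0] --> d.[0]^-1 * a.[0].
  apply: cvgM; last exact: continuous_horner.
  apply: cvgV; last exact: continuous_horner.
  by rewrite -detE scale0r addr0 det1 oner_neq0.
have <- : d.[0]^-1 * a.[0] = (u *m v) 0 0.
  by rewrite -entryE scale0r addr0 ?unitmx1// invmx1 mulmx1.
apply: cvg_trans lim; apply: near_eq_cvg.
by near=> t; rewrite entryE//; near: t; exact: near_unitmx1D.
Unshelve. all: by end_near. Qed.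

(** The transpose of P also satisfies the Penrose equations of C, hence equals
P by uniqueness, and the symmetric matrix P C is equal to its transpose C P. *)
Lemma pinv_comm C : C^T = C -> Defs.pinv C *m C = C *m Defs.pinv C.
Proof.
move=> sC; have := Defs.pinvP C; move eP : (Defs.pinv C) => P [p1 p2 p3 p4].
have sP : P^T = P.
  rewrite -{2}eP; apply: Defs.pinv_unique; split.
  - by rewrite -{1 2}sC -!trmx_mul mulmxA p1 sC.
  - by rewrite -{1}sC -!trmx_mul mulmxA p2.
  - by rewrite -{1 2}sC -!trmx_mul p4.
  - by rewrite -{1 2}sC -!trmx_mul p3.
by rewrite -p4 trmx_mul sC sP.
Qed.

Lemma mulmx_ridge C t : C^T = C -> C + t%:M \in unitmx ->
  1%:M + t *: Defs.pinv C \in unitmx ->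
  C *m invmx (C + t%:M)
  = invmx (1%:M + t *: Defs.pinv C) *m (C *m Defs.pinv C).
Proof.
move=> sC UC UP; have [p1 _ _ _] := Defs.pinvP C.
have key : (1%:M + t *: Defs.pinv C) *m C = C *m Defs.pinv C *m (C + t%:M).
  rewrite mulmxDl mul1mx mulmxDr p1 mul_mx_scalar -scalemxAl.
  by rewrite (pinv_comm C sC).
apply: (can_inj (mulKmx UP)); rewrite mulKVmx // mulmxA key.
by rewrite mulmxK.
Qed.

(** Writing c = w C brings in the product C (C + t I)^-1, which stays bounded
as t tends to 0 even when C is singular. *)
Lemma cvg_ridge C (c : 'rV[R]_n) (v : 'cV[R]_n) : C^T = C ->
  (forall t, 0 < t -> C + t%:M \in unitmx) -> (c <= C)%MS ->
  (c *m invmx (C + t%:M) *m v) 0 0 @[t --> 0^'+] -->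
  (c *m Defs.pinv C *m v) 0 0.
Proof.
move=> sC UC /submxP[w ->].
have lim := cvg_invmx1D (Defs.pinv C) w (C *m Defs.pinv C *m v).
have -> : w *m C *m Defs.pinv C *m v = w *m (C *m Defs.pinv C *m v).
  by rewrite !mulmxA.
apply: cvg_trans (cvg_at_right_filter lim); apply: near_eq_cvg.
near=> t.
have UP : 1%:M + t *: Defs.pinv C \in unitmx.
  by near: t; apply: cvg_within; exact: near_unitmx1D.
rewrite -(mulmxA w C) mulmx_ridge ?UC // ?mulmxA //.
Unshelve. all: by end_near. Qed.

End Resolvent.

Section Covariance.
Variables (R : realType) (T : Type) (n : nat).
Variables (K : T -> T -> R) (X : 'I_n -> T).
Hypothesis covK : covariance_function K.

Lemma cov_mx_sym : (cov_mx K X)^T = cov_mx K X.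
Proof. by apply/matrixP => i j; rewrite !mxE covK.1. Qed.

Lemma quad_cov_mxE (v : 'rV[R]_n) :
  (v *m cov_mx K X *m v^T) 0 0
  = \sum_(i < n) \sum_(j < n) v 0 i * v 0 j * K (X i) (X j).
Proof.
rewrite mxE exchange_big; apply: eq_bigr => j _.
rewrite !mxE mulr_suml; apply: eq_bigr => i _.
by rewrite !mxE mulrAC.
Qed.

Lemma unitmx_cov_mxD t : 0 < t -> cov_mx K X + t%:M \in unitmx.
Proof.
move=> t0; rewrite -row_free_unit -kermx_eq0; apply/rowV0P => u.
move/sub_kermxP => u0.
have : (u *m (cov_mx K X + t%:M) *m u^T) 0 0 = 0 by rewrite u0 mul0mx mxE.
rewrite mulmxDr mulmxDl mxE mul_mx_scalar -scalemxAl quad_cov_mxE.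
have psd := covK.2 n X (u 0).
rewrite [X in _ + X = _ -> _]mxE => e.
have uu0 : 0 <= (u *m u^T) 0 0.
  by rewrite mxE sumr_ge0 // => j _; rewrite [u^T _ _]mxE -expr2 sqr_ge0.
have /eqP : (u *m u^T) 0 0 = 0 by nra.
rewrite mxE psumr_eq0 => [/allP h|j _]; last first.
  by rewrite [u^T _ _]mxE -expr2 sqr_ge0.
apply/rowP => j; move: (h j (mem_index_enum _)).
by rewrite [u^T _ _]mxE [RHS]mxE /= mulf_eq0 orbb => /eqP.
Qed.

(** Positive semidefiniteness on the data points with x adjoined, x carrying
the weight s. *)
Lemma quad_cov_vec_ge0 (x : T) (s : R) (v : 'rV[R]_n) :
  0 <= s ^+ 2 * K x x + 2 * s * (v *m cov_vec K X x) 0 0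
       + (v *m cov_mx K X *m v^T) 0 0.
Proof.
pose u (i : 'I_n.+1) := if unlift ord0 i is Some j then X j else x.
pose a (i : 'I_n.+1) := if unlift ord0 i is Some j then v 0 j else s.
have u0 : u ord0 = x by rewrite /u unlift_none.
have a0 : a ord0 = s by rewrite /a unlift_none.
have uS j : u (lift ord0 j) = X j by rewrite /u liftK.
have aS j : a (lift ord0 j) = v 0 j by rewrite /a liftK.
have cross1 : \sum_(j < n) s * v 0 j * K x (X j)
    = s * (v *m cov_vec K X x) 0 0.
  by rewrite mxE mulr_sumr; apply: eq_bigr => j _; rewrite mxE mulrA.
have cross2 : \sum_(i < n) v 0 i * s * K (X i) x
    = s * (v *m cov_vec K X x) 0 0.
  rewrite -cross1; apply: eq_bigr => i _.
  by rewrite covK.1 (mulrC s).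
apply: (le_trans (covK.2 n.+1 u a)).
rewrite le_eqVlt; apply/orP; left; apply/eqP.
rewrite big_ord_recl (big_ord_recl n) a0 u0.
under eq_bigr do rewrite aS uS.
under [X in _ + X]eq_bigr do rewrite big_ord_recl a0 u0 aS uS.
under [X in _ + X]eq_bigr do under eq_bigr do rewrite aS uS.
by rewrite big_split /= -quad_cov_mxE cross1 cross2; ring.
Qed.

(** A vector v in the kernel of the covariance matrix makes the quadratic form
above s^2 k + 2 s b, with k = K x x and b = v c. It is nonnegative for all s
only if b = 0. *)
Lemma cov_vec_ker0 (x : T) (v : 'rV[R]_n) :
  v *m cov_mx K X = 0 -> v *m cov_vec K X x = 0.
Proof.
move=> v0; apply/matrixP => i j; rewrite !ord1 [RHS]mxE.
set b := (_ *m _) 0 0; pose k := K x x.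
have h s : 0 <= s ^+ 2 * k + 2 * s * b.
  have := quad_cov_vec_ge0 x s v.
  by rewrite v0 mul0mx [X in _ + X]mxE addr0.
have k0 : 0 <= k by have := h 1; have := h (-1); lra.
(* s = - b / (k + 1) is close enough to the minimiser - b / k, and is defined
   also when k = 0. *)
have k1 : k + 1 != 0 by rewrite gt_eqF //; lra.
have := h (- b / (k + 1)).
have -> : (- b / (k + 1)) ^+ 2 * k + 2 * (- b / (k + 1)) * b
    = - (b ^+ 2 * ((k + 2) / (k + 1) ^+ 2)) by field.
rewrite oppr_ge0 pmulr_lle0; last by rewrite divr_gt0 ?exprn_gt0 //; lra.
by move=> b0; apply/eqP; rewrite -sqrf_eq0 eq_le b0 sqr_ge0.
Qed.

Lemma cov_vec_sub (x : T) : ((cov_vec K X x)^T <= cov_mx K X)%MS.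
Proof.
rewrite submxE -trmx_eq0 trmx_mul trmxK; apply/eqP/row_matrixP => i.
rewrite row_mul row0; apply: cov_vec_ker0.
by rewrite -row_mul -{2}cov_mx_sym -trmx_mul mulmx_coker trmx0 row0.
Qed.

Lemma cvg_cov_ridge (x : T) (v : 'cV[R]_n) :
  ((cov_vec K X x)^T *m invmx (cov_mx K X + t%:M) *m v) 0 0 @[t --> 0^'+] -->
  ((cov_vec K X x)^T *m Defs.pinv (cov_mx K X) *m v) 0 0.
Proof.
exact: cvg_ridge cov_mx_sym unitmx_cov_mxD (cov_vec_sub x).
Qed.

End Covariance.

Theorem mainTheorem3 (R : realType) (d n : nat) (D : set 'cV[R]_d)
    (K : D -> D -> R) (X : 'I_n -> D) (y : 'cV[R]_n) :
  covariance_function K ->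
  forall x x' : D,
    (mean_Nug K X y tau2 x @[tau2 --> 0^'+] --> mean_PI K X y x) /\
    (cov_Nug K X tau2 x x' @[tau2 --> 0^'+] --> cov_PI K X x x').
Proof.
move=> covK x x'; split; first exact: cvg_cov_ridge.
by apply: cvgB; [exact: cvg_cst|exact: cvg_cov_ridge].
Qed.
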